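(* Let $n,m\ge 1$. Any $(n,1,m)$ convolutional code with generator polynomials $P_1,P_2,\ldots,P_n\in\{0,1\}^{m+1}$ satisfying the condition $$\{z\in\{1,2,\ldots,n\}\mid P_z.1=1\}\neq\emptyset$$ is an adaptive code of order $m$; that is, there is an adaptive code $c:\{0,1\}\times\{0,1\}^{\le m}\to\{0,1\}^{+}$ of order $m$ such that for every $x\in\{0,1\}^{+}$ the string $\overline{c}(x)$ is the encoding of $x$ by the convolutional code.
   Context: For an alphabet $\Sigma$ (finite nonempty set), $\Sigma^{*}$ is the set of finite strings over $\Sigma$, $\lambda$ the empty string, $\Sigma^{+}=\Sigma^{*}\setminus\{\lambda\}$, and $\Sigma^{\le n}$ the set of strings over $\Sigma$ of length at most $n$ (including $\lambda$). For a tuple $P$, $P.i$ denotes its $i$-th component. Adaptive code of order $n$ ($n\ge1$): for alphabets $\Sigma,\Delta$, a function $c:\Sigma\times\Sigma^{\le n}\to\Delta^{+}$ is an adaptive code of order $n$ if the map $\overline{c}:\Sigma^{*}\to\Delta^{*}$ given by $\overline{c}(\lambda)=\lambda$ and $$\overline{c}(\sigma_1\sigma_2\ldots\sigma_t)=c(\sigma_1,u_1)\,c(\sigma_2,u_2)\cdots c(\sigma_t,u_t),\qquad u_i=\sigma_{\max(1,i-n)}\ldots\sigma_{i-1},\ u_1=\lambda,$$ (so $u_i$ consists of the previous $n$ symbols, or of all previous symbols if there are fewer than $n$) for all $\sigma_1\ldots\sigma_t\in\Sigma^{+}$, is injective. Convolutional code: an $(n,1,m)$ convolutional code ($n$ output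 bits, one input bit, $m$ memory registers) has an encoding procedure entirely defined by $n$ generator polynomials $P_1,\ldots,P_n$, represented as binary $(m+1)$-tuples. An input string $x=x_1x_2\ldots x_t\in\{0,1\}^{+}$ is encoded by $y=y_1y_2\ldots y_{nt}\in\{0,1\}^{nt}$, where for $i\in\{0,1,\ldots,t-1\}$ and $j\in\{1,\ldots,n\}$ $$y_{in+j}=\bigoplus_{z\in\{1,\ldots,m+1\},\ P_j.z=1} w_{i-z+1},$$ $\oplus$ denotes addition modulo 2 (the empty sum being $0$), and, for $l\in\{0,1,\ldots,m\}$, $w_{i-l}=x_{i-l+1}$ if $i-l+1\ge 1$ and $w_{i-l}=0$ otherwise. *)

(* Defs.v *)
From mathcomp Require Import all_boot.

Set Implicit Arguments.
Unset Strict Implicit.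
Unset Printing Implicit Defensive.

(* T^+; strings over T of length at most n are the library's n.-bseq T. *)
Definition nestring (T : Type) := {s : seq T | ~~ nilp s}.

(* Positions are counted from 0, so the subtraction truncated at 0 plays the
   role of max(1, i - n): the context of position i is s_(max(0, i-n)) ...
   s_(i-1). *)
Definition prev (T : Type) (n : nat) (s : seq T) (i : nat) : seq T :=
  drop (i - n) (take i s).

Lemma size_prev (T : Type) (n : nat) (s : seq T) (i : nat) :
  size (prev n s i) <= n.
Proof.
by rewrite /prev size_drop size_take_min leq_subLR addnC -leq_subLR leq_sub2r // geq_minl.
Qed.

Definition context (T : Type) (n : nat) (s : seq T) (i : nat) : n.-bseq T :=
  Bseq (size_prev n s i).

(* For s = [::] the index type is empty and the value is [::]. *)
Definition adaptive_ext (Sigma Delta : Type) (n : nat)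
    (c : Sigma * n.-bseq Sigma -> nestring Delta) (s : seq Sigma) : seq Delta :=
  flatten [seq val (c (tnth (in_tuple s) i, context n s i)) | i : 'I_(size s)].

Definition adaptive_code (Sigma Delta : finType) (n : nat)
    (c : Sigma * n.-bseq Sigma -> nestring Delta) : Prop :=
  [/\ 0 < #|Sigma|, 0 < #|Delta|, 0 < n & injective (adaptive_ext c)].

(* The register content w_(i - l): the input bit read l steps before step i
   (steps counted from 0), and 0 if there is no such step. *)
Definition register (x : seq bool) (i l : nat) : bool :=
  if l <= i then nth false x (i - l) else false.

(* With components of P j counted from 0, the component z (P_j.(z+1) in the
   1-based convention) selects w_(i - z). *)
Definition conv_bit (n m : nat) (P : 'I_n -> m.+1.-tuple bool)
    (x : seq bool) (i : nat) (j : 'I_n) : bool :=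
  \big[addb/false]_(z < m.+1 | tnth (P j) z) register x i z.

Definition conv_encode (n m : nat) (P : 'I_n -> m.+1.-tuple bool)
    (x : seq bool) : seq bool :=
  flatten [seq [seq conv_bit P x i j | j : 'I_n] | i <- iota 0 (size x)].

Lemma size_conv_encode (n m : nat) (P : 'I_n -> m.+1.-tuple bool)
    (x : seq bool) :
  size (conv_encode P x) = n * size x.
Proof.
rewrite size_flatten /shape -map_comp (eq_map (g := fun=> n)); last first.
  by move=> i /=; rewrite size_image card_ord.
by rewrite sumnE big_map big_const_seq count_predT size_iota iter_addn_0.
Qed.

Lemma nth_conv_encode (n m : nat) (P : 'I_n -> m.+1.-tuple bool)
    (x : seq bool) (i : nat) (j : 'I_n) :
  i < size x -> nth false (conv_encode P x) (i * n + j) = conv_bit P x i j.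
Proof.
rewrite /conv_encode => ltix; pose F k := [seq conv_bit P x k j | j : 'I_n].
have sF k : size (F k) = n by rewrite size_image card_ord.
suff H t b : i < t ->
    nth false (flatten [seq F k | k <- iota b t]) (i * n + j)
      = conv_bit P x (b + i) j by rewrite H.
elim: t b i {ltix} => // t IHt b [|i] ltit /=; rewrite nth_cat sF.
  rewrite ltn_ord addn0 (nth_map j) ?size_enum_ord ?ltn_ord //.
  by rewrite nth_ord_enum.
by rewrite mulSn -addnA ltnNge leq_addr /= addKn IHt // addSnnS.
Qed.

(* Main.v *)
Require Import Defs.
From mathcomp Require Import all_boot.

(* Each output block depends only on the current bit and the previous [m] bits,
   so the code word of [(b, u)] is the block that the encoder emits on reading
   [b] after [u].  Since some generator [P_z] has [P_z.1 = 1], output [z] is the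
   current bit xored with a function of the earlier bits, so the input can be
   decoded one bit at a time. *)

Section ConvolutionalCode.

Variables (n m : nat) (P : 'I_n -> m.+1.-tuple bool).
Implicit Types (x y : seq bool) (b : bool) (u : m.-bseq bool).

Definition conv_block x (i : nat) : seq bool :=
  [seq conv_bit P x i j | j : 'I_n].

(** The context followed by the current bit is the segment of [x] that ends at position [i], and a
    lag of at most [m] leaves this segment only where it would also leave [x]; both registers then
    hold 0. *)
Lemma register_prev x (i z : nat) : i < size x -> z <= m ->
  register (rcons (Defs.prev m x i) (nth false x i)) (size (Defs.prev m x i)) z =
  register x i z.
Proof.
move=> lt_ix le_zm.
have size_pre : size (take i x) = i by rewrite size_takel // ltnW.
have -> : rcons (Defs.prev m x i) (nth false x i) = drop (i - m) (take i.+1 x).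
  by rewrite (take_nth false) // drop_rcons // size_pre leq_subr.
rewrite /register /Defs.prev size_drop size_pre.
(* With truncated subtraction, [i - (i - m)] is [minn i m], the length of the context. *)
have -> : (z <= i - (i - m)) = (z <= i) by rewrite -minnE leq_min le_zm andbT.
case: ifP => // le_zi.
have le_z : z <= i - (i - m) by rewrite -minnE leq_min le_zi.
by rewrite nth_drop addnBA // subnKC ?leq_subr // nth_take // ltnS leq_subr.
Qed.

Lemma conv_block_prev x (i : nat) : i < size x ->
  conv_block (rcons (Defs.prev m x i) (nth false x i)) (size (Defs.prev m x i)) =
  conv_block x i.
Proof.
move=> lt_ix; apply: eq_map => j; apply: eq_bigr => z _.
by apply: register_prev => //; rewrite -ltnS.
Qed.

(** Splitting off lag 0 isolates the bit to be decoded: the remaining lags are positive and read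
    only earlier bits. *)
Lemma conv_bit_leading x (i : nat) (j : 'I_n) : tnth (P j) ord0 ->
  conv_bit P x i j =
  nth false x i (+)
  \big[addb/false]_(z < m | tnth (P j) (lift ord0 z)) register x i z.+1.
Proof.
move=> Pj0.
by rewrite /conv_bit big_mkcond big_ord_recl Pj0 -big_mkcond /register subn0.
Qed.

Lemma eq_register_succ x y (i z : nat) :
  (forall k, k < i -> nth false x k = nth false y k) ->
  register x i z.+1 = register y i z.+1.
Proof.
move=> eq_xy; rewrite /register; case: ifP => // lt_zi.
by rewrite eq_xy // ltn_subrL (leq_ltn_trans _ lt_zi).
Qed.

Lemma conv_encode_inj : (exists j, tnth (P j) ord0) ->
  injective (conv_encode P).
Proof.
(* The index [j] itself shows that [n] is positive, so the length of the output determines that of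
   the input. *)
case=> j Pj0 x y eq_enc; have n_gt0 : 0 < n by case: n j {Pj0} => [[]|].
have eq_size : size x = size y.
  have /eqP := congr1 size eq_enc.
  by rewrite !size_conv_encode eqn_pmul2l // => /eqP.
apply: (@eq_from_nth _ false) => // i.
elim/ltn_ind: i => i IHi lt_ix; have lt_iy : i < size y by rewrite -eq_size.
have := nth_conv_encode P j lt_ix.
rewrite eq_enc (nth_conv_encode P j lt_iy) !conv_bit_leading //.
(* By the induction hypothesis the sums over earlier bits agree, so they cancel and leave the bits
   at [i]. *)
rewrite (eq_bigr (fun z : 'I_m => register x i z.+1)).
  by move/addIb.
move=> z _; apply: eq_register_succ => k lt_ki.
by rewrite IHi // (ltn_trans lt_ki).
Qed.

Hypothesis n_gt0 : 0 < n.

Lemma conv_block_nonempty x (i : nat) : ~~ nilp (conv_block x i).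
Proof. by rewrite /nilp size_image card_ord -lt0n. Qed.

(** The new bit is appended to its context, so its position there is the length of the context,
    which is below [m] near the start of the input. *)
Definition conv_adaptive (bu : bool * m.-bseq bool) : nestring bool :=
  exist (fun s => ~~ nilp s) _
    (conv_block_nonempty (rcons bu.2 bu.1) (size bu.2)).

Lemma adaptive_ext_conv x : adaptive_ext conv_adaptive x = conv_encode P x.
Proof.
rewrite /adaptive_ext /conv_encode -val_enum_ord -map_comp.
congr flatten; apply: eq_map => i /=.
by rewrite (tnth_nth false) conv_block_prev.
Qed.

End ConvolutionalCode.

Theorem theorem5p1 (n m : nat) (hn : 1 <= n) (hm : 1 <= m)
    (P : 'I_n -> m.+1.-tuple bool)
    (hP : [set z : 'I_n | tnth (P z) ord0] != set0) :
  exists c : bool * m.-bseq bool -> nestring bool,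
    adaptive_code c /\
    (forall x : seq bool, x <> [::] -> adaptive_ext c x = conv_encode P x).
Proof.
exists (conv_adaptive n m P hn); split; last first.
  by move=> x _; apply: adaptive_ext_conv.
split; rewrite ?card_bool // => x y; rewrite !adaptive_ext_conv.
apply: conv_encode_inj; have [z] := set0Pn _ hP.
by rewrite inE => Pz; exists z.
Qed.
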